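(* For a given instance $I$ of SPA-ST, the following hold: (1) each lecturer is assigned the same number of students in all super-stable matchings; (2) exactly the same students are unassigned in all super-stable matchings; (3) a project offered by a lecturer who is undersubscribed (in a super-stable matching) is assigned the same number of students in all super-stable matchings.
   Context: An instance $I$ of SPA-ST consists of a set $\mathcal{S}$ of students, a set $\mathcal{P}$ of projects and a set $\mathcal{L}$ of lecturers. Each student $s_i$ has a set $A_i\subseteq\mathcal{P}$ of acceptable projects and a preference list ranking $A_i$ as a strict ranking of ties (a tie is a set of equally preferred entries; a non-tied entry is a tie of length one). Each lecturer $l_k$ offers a non-empty set $P_k$ of projects, the sets $P_k$ partitioning $\mathcal{P}$; $l_k$ has a capacity $d_k\in\mathbb{Z}^+$ and a preference list ranking, as a strict ranking of ties, exactly those students who find at least one project in $P_k$ acceptable. Each project $p_j$ has capacity $c_j\in\mathbb{Z}^+$, with $\max\{c_j:p_j\in P_k\}\le d_k\le\sum\{c_j:p_j\in P_k\}$. A matching is a set $M$ of acceptable (student, project) pairs with each student in at most one pair, $|M(p_j)|\le c_j$ and $|M(l_k)|\le d_k$, where $M(p_j)$ is the set of students assigned to $p_j$ and $M(l_k)$ the set of students assigned to projects in $P_k$; $M(s_i)$ is the project of $s_i$ if any. A project/lecturer is undersubscribed or full according as its number of assignees is less than or equal to its capacity. Let $l_k$ be the lecturer offering $p_j$. $M$ is super-stable if no acceptable pair $(s_i,p_j)\notin M$ satisfies: (a) $s_i$ is unassigned, or prefers $p_j$ to $M(s_i)$ or is indifferent between them, and (b) either (i) $p_j$ and $l_k$ are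 undersubscribed, or (ii) $p_j$ is undersubscribed, $l_k$ is full and either $s_i\in M(l_k)$ or $l_k$ prefers $s_i$ to a worst student in $M(l_k)$ or is indifferent between them, or (iii) $p_j$ is full and $l_k$ prefers $s_i$ to a worst student in $M(p_j)$ or is indifferent between them. *)

(* Defs.v *)
From mathcomp Require Import all_boot.

Set Implicit Arguments.
Unset Strict Implicit.
Unset Printing Implicit Defensive.

Section TieRanking.

Variable T : finType.

(* A preference list is the sequence of its ties, most preferred tie first;
   the ties of a ranking of A are non-empty, disjoint, and cover A. *)
Definition tie_ranking (A : {set T}) (r : seq {set T}) : bool :=
  [&& set0 \notin r,
      pairwise (fun X Y : {set T} => [disjoint X & Y]) r
    & \bigcup_(X <- r) X == A].

(* Position of the tie containing x (size r if x is not ranked by r). *)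
Definition rank (r : seq {set T}) (x : T) : nat :=
  find (fun X : {set T} => x \in X) r.

Definition prefers (r : seq {set T}) (x y : T) : bool := rank r x < rank r y.

Definition indifferent (r : seq {set T}) (x y : T) : bool :=
  rank r x == rank r y.

Definition worst (r : seq {set T}) (B : {set T}) (w : T) : bool :=
  (w \in B) && [forall x in B, ~~ prefers r w x].

(* x is preferred to a worst element of B, or tied with it. *)
Definition beats_worst (r : seq {set T}) (B : {set T}) (x : T) : bool :=
  [exists w, worst r B w && (prefers r x w || indifferent r x w)].

End TieRanking.

(* The partition of the projects among the lecturers is given by the map
   sending a project to the lecturer offering it. *)
Record spa_st (S P L : finType) := SpaSt {
  acceptable : S -> {set P};
  student_pref : S -> seq {set P};
  lecturer_of : P -> L;
  lecturer_pref : L -> seq {set S};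
  project_cap : P -> nat;
  lecturer_cap : L -> nat;
  offered := fun l : L => [set p | lecturer_of p == l];
  student_prefP : forall s, tie_ranking (acceptable s) (student_pref s);
  offered_neq0 : forall l, offered l != set0;
  lecturer_prefP : forall l,
    tie_ranking [set s | [exists p in offered l, p \in acceptable s]]
                (lecturer_pref l);
  project_cap_gt0 : forall p, 0 < project_cap p;
  lecturer_cap_gt0 : forall l, 0 < lecturer_cap l;
  lecturer_cap_bounds : forall l,
    \max_(p in offered l) project_cap p <= lecturer_cap l
      <= \sum_(p in offered l) project_cap p
}.

Section Matchings.

Variables (S P L : finType) (I : spa_st S P L) (M : {set S * P}).

Definition project_students (p : P) : {set S} := [set s | (s, p) \in M].

Definition lecturer_students (l : L) : {set S} :=
  [set s | [exists p in offered I l, (s, p) \in M]].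

Definition unassigned : {set S} := [set s | [forall p, (s, p) \notin M]].

Definition matching : bool :=
  [&& [forall s, forall p, ((s, p) \in M) ==> (p \in acceptable I s)],
      [forall s, #|[set p | (s, p) \in M]| <= 1],
      [forall p, #|project_students p| <= project_cap I p]
    & [forall l, #|lecturer_students l| <= lecturer_cap I l]].

Definition project_undersubscribed (p : P) : bool :=
  #|project_students p| < project_cap I p.

Definition project_full (p : P) : bool :=
  #|project_students p| == project_cap I p.

Definition lecturer_undersubscribed (l : L) : bool :=
  #|lecturer_students l| < lecturer_cap I l.

Definition lecturer_full (l : L) : bool :=
  #|lecturer_students l| == lecturer_cap I l.

Definition student_willing (s : S) (p : P) : bool :=
  (s \in unassigned) ||
  [exists q, ((s, q) \in M) &&
    (prefers (student_pref I s) p q || indifferent (student_pref I s) p q)].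

Definition lecturer_willing (s : S) (p : P) : bool :=
  let l := lecturer_of I p in
  [|| project_undersubscribed p && lecturer_undersubscribed l,
      [&& project_undersubscribed p, lecturer_full l
        & (s \in lecturer_students l)
          || beats_worst (lecturer_pref I l) (lecturer_students l) s]
    | project_full p
        && beats_worst (lecturer_pref I l) (project_students p) s].

Definition blocking_pair (s : S) (p : P) : bool :=
  [&& p \in acceptable I s, (s, p) \notin M,
      student_willing s p & lecturer_willing s p].

Definition super_stable : bool :=
  matching && [forall s, forall p, ~~ blocking_pair s p].

End Matchings.

(* Main.v *)
Require Import Defs.
From mathcomp Require Import all_boot zify.

(** Compare two super-stable matchings [M] and [N]. Colour a student whose
    assignment differs by [C] if she would move from [M] to her place in [N],
    and by [D] otherwise, in which case she would move from [N] to her place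
    in [M]. Stability says that [M] rejects every [C]-student where [N] puts
    her, and conversely for [D]. Since all rejections are strict, a capacity
    count shows that each lecturer has in [N] at most as many [C]-students as
    in [M], and in [M] at most as many [D]-students as in [N]. All [C]-students
    are assigned in [N] and all [D]-students in [M], so summing over the
    lecturers turns all these inequalities into equalities. *)

Set Implicit Arguments.
Unset Strict Implicit.
Unset Printing Implicit Defensive.

(** * Rankings and elementary counting *)

Lemma worst_exists (T : finType) (r : seq {set T}) (B : {set T}) (x : T) :
  x \in B -> exists w, worst r B w.
Proof.
move=> xB; case: (arg_maxnP (rank r) xB) => w wB wmax; exists w.
apply/andP; split; first exact: wB.
by apply/forall_inP => y yB; rewrite /prefers -leqNgt; exact: wmax.
Qed.

(** A tie with a worst element already counts as beating it, so an [x] that fails to do so is ranked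
    strictly behind all of [B]. This is the source of the strictness of rejections. *)
Lemma beats_worstPn (T : finType) (r : seq {set T}) (B : {set T}) (x : T) :
  ~~ beats_worst r B x -> forall y, y \in B -> prefers r y x.
Proof.
move=> nbeats y yB; have [w wW] := worst_exists r yB.
move/existsPn/(_ w): nbeats; rewrite wW /= /prefers /indifferent.
case/andP: wW => _ /forall_inP/(_ y yB); rewrite /prefers; lia.
Qed.

Lemma eq_of_leq_sum (T : finType) (Q : pred T) (f g : T -> nat) :
  (forall i, Q i -> f i <= g i) -> \sum_(i | Q i) g i <= \sum_(i | Q i) f i ->
  forall i, Q i -> f i = g i.
Proof.
move=> fg gf i Qi; apply/eqP; rewrite eqn_leq fg //=.
move: gf; rewrite (bigD1 i) //= [leqRHS](bigD1 i) //=.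
have : \sum_(j | Q j && (j != i)) f j <= \sum_(j | Q j && (j != i)) g j.
  by apply: leq_sum => j /andP[Qj _]; exact: fg.
lia.
Qed.

Lemma card_split_colors (T : finType) (A C D : {set T}) : [disjoint C & D] ->
  #|A| = #|A :&: C| + #|A :&: D| + #|A :&: ~: (C :|: D)|.
Proof.
move=> dis; rewrite -(cardsID (C :|: D) A) setDE setIUr cardsU.
suff -> : (A :&: C) :&: (A :&: D) = set0 by rewrite cards0 subn0.
by rewrite -setIIr (disjoint_setI0 dis) setI0.
Qed.

Lemma sum_by_lecturer (S P L : finType) (I : spa_st S P L) (f : P -> nat) :
  \sum_p f p = \sum_l \sum_(p in offered I l) f p.
Proof.
rewrite (partition_big (lecturer_of I) xpredT) //=.
by apply: eq_bigr => l _; apply: eq_bigl => p; rewrite inE.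
Qed.

(** * Matchings and rejections *)

Section Rejection.

Variables (S P L : finType) (I : spa_st S P L).
Implicit Types (M N : {set S * P}) (C D : {set S}).

Lemma matching_uniq M s p q :
  matching I M -> (s, p) \in M -> (s, q) \in M -> p = q.
Proof.
case/and4P=> _ /forallP/(_ s)/card_le1P uni _ _ sp sq.
by have := uni p; rewrite inE sp => /(_ isT q); rewrite !inE sq => /esym/eqP.
Qed.

(** Double counting: a student has at most one project, so she contributes at most 1 to the sum. *)
Lemma sum_card_project_students M C (Q : pred P) : matching I M ->
  \sum_(p | Q p) #|project_students M p :&: C| =
  #|[set s in C | [exists p, Q p && ((s, p) \in M)]]|.
Proof.
move=> mM; have cardE p : #|project_students M p :&: C| = \sum_(s in C) ((s, p) \in M).
  by rewrite setIC -sum1_card big_mkcond [RHS]big_mkcond; apply: eq_bigr => s _;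
     rewrite !inE; case: (s \in C); case: ((s, p) \in M).
under eq_bigr => p _ do rewrite cardE.
rewrite exchange_big /= -sum1_card big_mkcond [RHS]big_mkcond; apply: eq_bigr => s _.
rewrite inE; case: (s \in C) => //=.
case: existsP => [[p /andP[Qp sp]]|nex].
  rewrite (bigD1 p) //= sp big1 // => q /andP[_ /eqP nqp].
  by case sq: ((s, q) \in M) => //; case: nqp; exact: matching_uniq sq sp.
by rewrite big1 // => p Qp; case sp: ((s, p) \in M) => //; case: nex; exists p; rewrite Qp.
Qed.

Lemma card_lecturer_students M l : matching I M ->
  #|lecturer_students I M l| = \sum_(p in offered I l) #|project_students M p|.
Proof.
move=> mM; under eq_bigr => p _ do rewrite -[project_students M p]setIT.
by rewrite (sum_card_project_students _ (mem (offered I l))) //; apply: eq_card => s; rewrite !inE.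
Qed.

Lemma mem_lecturer_students M s p :
  (s, p) \in M -> s \in lecturer_students I M (lecturer_of I p).
Proof. by move=> sp; rewrite inE; apply/exists_inP; exists p; rewrite ?inE. Qed.

Definition rejected_by_project M s p : bool :=
  project_full I M p &&
  [forall t in project_students M p,
     prefers (lecturer_pref I (lecturer_of I p)) t s].

Definition rejected_by_lecturer M s l : bool :=
  lecturer_full I M l &&
  [forall t in lecturer_students I M l, prefers (lecturer_pref I l) t s].

Definition rejected M s p : bool :=
  rejected_by_project M s p || rejected_by_lecturer M s (lecturer_of I p).

Lemma rejected_prefers M s t p : rejected M s p -> (t, p) \in M ->
  prefers (lecturer_pref I (lecturer_of I p)) t s.
Proof.
move=> /orP[] /andP[_ /forall_inP pref] tp; apply: pref; first by rewrite inE.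
exact: mem_lecturer_students.
Qed.

(** As the pair does not block, (b) fails: a full [p] rejects [s] itself, while an undersubscribed
    [p] forces its lecturer to be full and to reject [s]. *)
Lemma super_stable_rejected M s p : super_stable I M ->
  p \in acceptable I s -> (s, p) \notin M -> student_willing I M s p ->
  rejected M s p.
Proof.
case/andP=> /and4P[_ _ /forallP/(_ p) capp /forallP/(_ (lecturer_of I p)) capl].
move=> /forallP/(_ s)/forallP/(_ p) + acc spM will.
rewrite /blocking_pair acc spM will /= /lecturer_willing !negb_or.
have [pu|pf] := boolP (project_undersubscribed I M p); last first.
  have {}pf : project_full I M p.
    by move: pf; rewrite /project_undersubscribed /project_full; lia.
  rewrite pf => /and3P[_ _ /beats_worstPn rej]; apply/orP; left.
  rewrite /rejected_by_project pf.
  exact/forall_inP.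
have [lu|lf] := boolP (lecturer_undersubscribed _ _ _) => //.
have {}lf : lecturer_full I M (lecturer_of I p).
  by move: lf; rewrite /lecturer_undersubscribed /lecturer_full; lia.
rewrite lf /= negb_or => /andP[/andP[_ /beats_worstPn rej] _]; apply/orP; right.
by rewrite /rejected_by_lecturer lf; exact/forall_inP.
Qed.

(** Isolates what the count needs from stability. The conditions are symmetric under exchanging [M]
    with [N] and [C] with [D], so inequalities are proved for [C] only. *)
Record rejection_coloring M N C D : Prop := RejectionColoring {
  coloring_matchingl : matching I M;
  coloring_matchingr : matching I N;
  coloring_disjoint : [disjoint C & D];
  coloring_unchanged :
    forall s p, s \notin C :|: D -> ((s, p) \in M) = ((s, p) \in N);
  coloring_assignedl : forall s, s \in C -> exists p, (s, p) \in N;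
  coloring_assignedr : forall s, s \in D -> exists p, (s, p) \in M;
  coloring_rejectedl : forall s p, s \in C -> (s, p) \in N -> rejected M s p;
  coloring_rejectedr : forall s p, s \in D -> (s, p) \in M -> rejected N s p
}.

Lemma rejection_coloring_sym M N C D :
  rejection_coloring M N C D -> rejection_coloring N M D C.
Proof.
case=> mM mN dis unch aC aD rC rD; split=> //; first by rewrite disjoint_sym.
by move=> s p; rewrite setUC => /unch.
Qed.

(** * Comparing colours at a project and at a lecturer *)

Lemma unchanged_part M N C D p : rejection_coloring M N C D ->
  project_students M p :&: ~: (C :|: D) = project_students N p :&: ~: (C :|: D).
Proof.
move=> col; apply/setP => s; rewrite in_setI [RHS]in_setI in_setC.
by have [|sU] := boolP (s \in C :|: D); rewrite ?andbF // !inE (coloring_unchanged col).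
Qed.

Lemma card_projectl M N C D p : rejection_coloring M N C D ->
  #|project_students M p| = #|project_students M p :&: C| +
    #|project_students M p :&: D| + #|project_students M p :&: ~: (C :|: D)|.
Proof. by move=> col; apply: card_split_colors; exact: coloring_disjoint col. Qed.

Lemma card_projectr M N C D p : rejection_coloring M N C D ->
  #|project_students N p| = #|project_students N p :&: C| +
    #|project_students N p :&: D| + #|project_students M p :&: ~: (C :|: D)|.
Proof.
move=> col; rewrite (unchanged_part p col).
by apply: card_split_colors; exact: coloring_disjoint col.
Qed.

(** If [N] puts a [C]-student at [p], then [M] fills [p] with students strictly preferred to her. A
    [D]-student among them would, by her rejection in [N], be ranked strictly behind her. So [M] has
    only [C]-students and unchanged ones at [p], and at least as many in total as [N]. *)
Lemma project_color_le M N C D p : rejection_coloring M N C D ->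
  (forall s, s \in C -> (s, p) \in N -> rejected_by_project M s p) ->
  #|project_students N p :&: C| <= #|project_students M p :&: C|.
Proof.
move=> col rej.
have [-> | [s]] := set_0Vmem (project_students N p :&: C); first by rewrite cards0.
rewrite !inE => /andP[spN sC]; have /andP[/eqP full /forall_inP pref] := rej s sC spN.
have D0 : project_students M p :&: D = set0.
  apply/setP => t; rewrite !inE; apply/negP => /andP[tpM tD].
  have := rejected_prefers (coloring_rejectedr col tD tpM) spN.
  by have := pref t; rewrite inE /prefers => /(_ tpM); lia.
have : #|project_students N p| <= #|project_students M p|.
  by rewrite full; case/and4P: (coloring_matchingr col) => _ _ /forallP/(_ p).
rewrite (card_projectl p col) (card_projectr p col) D0 cards0; lia.
Qed.

(** If [l] itself rejects none of its [C]-students of [N], the bounds at its projects add up.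
    Otherwise [l] is full in [M], and the bound for [C] is deduced from the opposite bound for
    [D]. *)
Lemma lecturer_color_le M N C D l : rejection_coloring M N C D ->
  \sum_(p in offered I l) #|project_students N p :&: C| <=
  \sum_(p in offered I l) #|project_students M p :&: C|.
Proof.
move=> col; have col' := rejection_coloring_sym col.
have [|nex] := boolP [exists s in C, exists p in offered I l,
                        ((s, p) \in N) && rejected_by_lecturer M s l]; last first.
- apply: leq_sum => p pl; apply: (project_color_le col) => s sC spN.
  case/orP: (coloring_rejectedl col sC spN) => // rej.
  case/exists_inP: nex; exists s => //; apply/exists_inP; exists p => //.
  by move: pl rej; rewrite spN inE => /eqP ->.
- case/exists_inP=> s sC /exists_inP[p pl /andP[spN /andP[/eqP full /forall_inP pref]]].
  (* [l] strictly prefers all its students in [M] to [s], and has [s] in [N]: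
     so in [N] only projects, not [l] as a whole, can reject [D]-students. *)
  have leD : \sum_(q in offered I l) #|project_students M q :&: D| <=
             \sum_(q in offered I l) #|project_students N q :&: D|.
    apply: leq_sum => q ql; apply: (project_color_le col') => t tD tqM.
    case/orP: (coloring_rejectedr col tD tqM) => // /andP[_ /forall_inP prefN].
    move: pl ql; rewrite !inE => /eqP pl /eqP ql.
    have := prefN s; rewrite ql -{1}pl => /(_ (mem_lecturer_students spN)).
    have := pref t; rewrite -{1}ql => /(_ (mem_lecturer_students tqM)).
    rewrite /prefers; lia.
  (* From these totals, cancel the unchanged students and use [leD]. *)
  have : #|lecturer_students I N l| <= #|lecturer_students I M l|.
    by rewrite full; case/and4P: (coloring_matchingr col) => _ _ _ /forallP/(_ l).
  rewrite !card_lecturer_students;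
    [|exact: coloring_matchingl col|exact: coloring_matchingr col].
  under eq_bigr => q _ do rewrite (card_projectr q col).
  under [leqRHS]eq_bigr => q _ do rewrite (card_projectl q col).
  rewrite !big_split /=; lia.
Qed.

(** * Equalities from the global count *)

Lemma sum_color_assigned M N C D : rejection_coloring M N C D ->
  \sum_p #|project_students N p :&: C| = #|C|.
Proof.
move=> col; rewrite (sum_card_project_students C xpredT (coloring_matchingr col)).
apply: eq_card => s; rewrite inE; case sC: (s \in C) => //=; apply/existsP.
by have [p sp] := coloring_assignedl col sC; exists p.
Qed.

(** Summed over the lecturers, the bounds say that [M] assigns at least as many [C]-students as [N],
    and [N] assigns all of them. *)
Lemma coloring_assigned M N C D : rejection_coloring M N C D ->
  forall s, s \in C -> exists p, (s, p) \in M.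
Proof.
move=> col s sC; have mM := coloring_matchingl col.
have le : \sum_p #|project_students N p :&: C| <= \sum_p #|project_students M p :&: C|.
  by rewrite !(sum_by_lecturer I); apply: leq_sum => l _; exact: lecturer_color_le col.
move: le; rewrite (sum_color_assigned col) (sum_card_project_students C xpredT mM) => le.
have sub : [set t in C | [exists p, (t, p) \in M]] \subset C.
  by apply/subsetP => t; rewrite inE => /andP[].
have /eqP eqC : [set t in C | [exists p, (t, p) \in M]] == C by rewrite eqEcard sub.
by move: sC; rewrite -{1}eqC inE => /andP[_ /existsP].
Qed.

(** In total [M] assigns at most [#|C|] students of [C] and [N] exactly [#|C|], so no lecturer's
    bound can be strict. *)
Lemma lecturer_color_eq M N C D l : rejection_coloring M N C D ->
  \sum_(p in offered I l) #|project_students N p :&: C| =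
  \sum_(p in offered I l) #|project_students M p :&: C|.
Proof.
move=> col; have mM := coloring_matchingl col.
apply: (@eq_of_leq_sum _ xpredT
  (fun l => \sum_(p in offered I l) #|project_students N p :&: C|)
  (fun l => \sum_(p in offered I l) #|project_students M p :&: C|)) => // [k _|].
  exact: lecturer_color_le col.
rewrite -!sum_by_lecturer (sum_color_assigned col) (sum_card_project_students C xpredT mM).
by apply/subset_leq_card/subsetP => t; rewrite inE => /andP[].
Qed.

Lemma card_lecturer_students_eq M N C D l : rejection_coloring M N C D ->
  #|lecturer_students I M l| = #|lecturer_students I N l|.
Proof.
move=> col; rewrite !card_lecturer_students;
  [|exact: coloring_matchingr col|exact: coloring_matchingl col].
under eq_bigr => q _ do rewrite (card_projectl q col).
under [RHS]eq_bigr => q _ do rewrite (card_projectr q col).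
rewrite !big_split /= (lecturer_color_eq l col).
by rewrite (lecturer_color_eq l (rejection_coloring_sym col)).
Qed.

(** A lecturer undersubscribed in [M] rejects nobody as a whole, so the bound holds at each of its
    projects; equality of the lecturer's totals makes each bound an equality. *)
Lemma project_color_eq M N C D p : rejection_coloring M N C D ->
  lecturer_undersubscribed I M (lecturer_of I p) ->
  #|project_students N p :&: C| = #|project_students M p :&: C|.
Proof.
move=> col und; pose l := lecturer_of I p.
apply: (@eq_of_leq_sum _ (mem (offered I l))
  (fun p => #|project_students N p :&: C|) (fun p => #|project_students M p :&: C|)).
- move=> q; rewrite /= inE => /eqP ql; apply: (project_color_le col) => s sC sq.
  case/orP: (coloring_rejectedl col sC sq) => // /andP[+ _].
  by move: und; rewrite ql /l /lecturer_undersubscribed /lecturer_full; lia.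
- by rewrite (lecturer_color_eq l col).
- by rewrite /= inE.
Qed.

Lemma card_project_students_eq M N C D p : rejection_coloring M N C D ->
  lecturer_undersubscribed I M (lecturer_of I p) ->
  #|project_students M p| = #|project_students N p|.
Proof.
move=> col und; have col' := rejection_coloring_sym col.
rewrite (card_projectl p col) (card_projectr p col) (project_color_eq col und).
(* The lecturer is undersubscribed in [N] too, having equally many students there. *)
rewrite (project_color_eq col') // /lecturer_undersubscribed.
by rewrite -(card_lecturer_students_eq _ col).
Qed.

Lemma unassigned_sub M N C D : rejection_coloring M N C D ->
  unassigned M \subset unassigned N.
Proof.
move=> col; apply/subsetP => s; rewrite !inE => /forallP un; apply/forallP => p.
apply/negP => spN; suff [q] : exists q, (s, q) \in M by rewrite (negPf (un q)).
have [|sU] := boolP (s \in C :|: D).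
  by rewrite inE => /orP[/(coloring_assigned col)|/(coloring_assignedr col)].
by exists p; rewrite (coloring_unchanged col).
Qed.

(** * The colouring given by two super-stable matchings *)

Definition movers M N : {set S} :=
  [set s | [exists p, [&& (s, p) \in N, (s, p) \notin M & student_willing I M s p]]].

Lemma movers_rejected M N s p : super_stable I M -> matching I N ->
  s \in movers M N -> (s, p) \in N -> rejected M s p.
Proof.
move=> ssM mN; rewrite inE => /existsP[q /and3P[sqN sqM will]] spN.
rewrite (matching_uniq mN spN sqN); apply: super_stable_rejected => //.
by case/and4P: mN => /forallP/(_ s)/forallP/(_ q)/implyP acc _ _ _; exact: acc.
Qed.

(** If [N] drops the pair, then [s], unwilling to move back, has in [N] a project strictly preferred
    to [p]; this makes her a mover from [M] to [N]. *)
Lemma not_movers_sub M N s p : matching I M -> matching I N ->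
  s \notin movers M N -> s \notin movers N M -> (s, p) \in M -> (s, p) \in N.
Proof.
move=> mM mN; rewrite !inE => /existsPn nN /existsPn nM spM.
case spN: ((s, p) \in N) => //.
have := nM p; rewrite spM spN /= negb_or inE => /andP[/forallPn[q]].
rewrite negbK => sqN /existsPn/(_ q); rewrite sqN /= /prefers /indifferent => ranks.
have := nN q; rewrite sqN /=; case sqM: ((s, q) \in M) => /=.
  by rewrite (matching_uniq mM spM sqM) sqN in spN.
rewrite negb_or => /andP[_ /existsPn/(_ p)]; rewrite spM /= /prefers /indifferent.
move: ranks; lia.
Qed.

(** A student indifferent between two distinct projects is a mover in both directions; the set
    difference puts her in the first class only. *)
Lemma super_stable_coloring M N : super_stable I M -> super_stable I N ->
  rejection_coloring M N (movers M N) (movers N M :\: movers M N).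
Proof.
move=> ssM ssN; have [mM mN] : matching I M /\ matching I N.
  by split; [case/andP: ssM | case/andP: ssN].
split=> //.
- by rewrite -setI_eq0; apply/eqP/setP => s; rewrite in_setI in_setD in_set0; case: (s \in _).
- move=> s p; rewrite in_setU in_setD negb_or => /andP[nN]; rewrite nN /= => nM.
  by apply/idP/idP; apply: not_movers_sub.
- by move=> s; rewrite inE => /existsP[p /and3P[]]; exists p.
- by move=> s; rewrite !inE => /andP[_ /existsP[p /and3P[]]]; exists p.
- by move=> s p; exact: movers_rejected.
- by move=> s p; rewrite in_setD => /andP[_]; exact: movers_rejected.
Qed.

End Rejection.

Theorem theorem3 (S P L : finType) (I : spa_st S P L) :
  (forall M N : {set S * P}, super_stable I M -> super_stable I N ->
     forall l : L, #|lecturer_students I M l| = #|lecturer_students I N l|)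
  /\
  (forall M N : {set S * P}, super_stable I M -> super_stable I N ->
     unassigned M = unassigned N)
  /\
  (forall M N : {set S * P}, super_stable I M -> super_stable I N ->
     forall p : P, lecturer_undersubscribed I M (lecturer_of I p) ->
       #|project_students M p| = #|project_students N p|).
Proof.
split; [|split] => M N ssM ssN; have col := super_stable_coloring ssM ssN.
- by move=> l; exact: card_lecturer_students_eq col.
- apply/eqP; rewrite eqEsubset (unassigned_sub col).
  exact: unassigned_sub (rejection_coloring_sym col).
- by move=> p; exact: card_project_students_eq col.
Qed.
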